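(* Let $G$ be a connected graph on $n\ge2$ vertices. Let $0=\lambda_1<\lambda_2\le\cdots\le\lambda_n$ be the Laplacian eigenvalues with corresponding orthonormal eigenvectors $u_1=\frac1{\sqrt n}\mathbf 1,u_2,\dots,u_n$, and let $U=[u_2\ \cdots\ u_n]$, $D_L=\operatorname{diag}(1/\lambda_2,\dots,1/\lambda_n)$, $M_L=U^\top\Delta U$. Let $w=\sum_{i=2}^n a_iu_i$ be a unit vector in $\mathbf 1^\perp$ and let $a=(a_2,\dots,a_n)^\top$ denote its coordinate vector in the Laplacian eigenbasis. Then \[ a^\top M_La=\sum_{v\in V(G)}\delta(v)\,w(v)^2 . \] Consequently, the optimization problem $\max_{\|a\|=1}\bigl(2a^\top D_La+n\,a^\top M_La\bigr)$ may be written (via $w=Ua$) as \[ \max_{\substack{w\in\mathbf 1^\perp\\ \|w\|=1}}\Bigl(2w^\top L^\dagger w+n\sum_{v\in V(G)}\delta(v)w(v)^2\Bigr). \]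
   Context: $G=(V,E)$ is a finite, simple, connected, undirected, unweighted graph with vertex set $V=V(G)=\{1,\dots,n\}$. $L=D_G-A$ is its combinatorial Laplacian (degree matrix minus adjacency matrix). $\mathbf 1\in\mathbb R^n$ is the all-ones vector, $I$ the identity matrix, $\|\cdot\|$ the Euclidean norm. $L^\dagger$ is the Moore--Penrose inverse of $L$, i.e. the unique symmetric matrix with $LL^\dagger=L^\dagger L=I-\frac1n\mathbf 1\mathbf 1^\top$ and $L^\dagger\mathbf 1=\mathbf 0$. Put $d_i=(L^\dagger)_{ii}$, $D=\operatorname{diag}(d_1,\dots,d_n)$, $\bar d=\frac1n\operatorname{tr}(L^\dagger)$, and $\Delta=D-\bar d I$, whose diagonal entries $\delta_1,\dots,\delta_n$ are the resistance deviations; $\delta(v)=\delta_v$ and $w(v)=w_v$ denote the $v$-th coordinates. *)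

(* Defs.v *)
From mathcomp Require Import all_boot all_order all_algebra.
From mathcomp Require Import all_classical all_reals.

Set Implicit Arguments.
Unset Strict Implicit.
Unset Printing Implicit Defensive.

Import Order.TTheory GRing.Theory Num.Theory.
Local Open Scope classical_set_scope.
Local Open Scope ring_scope.

Definition simple_connected_graph (n : nat) (e : rel 'I_n) : Prop :=
  [/\ symmetric e, irreflexive e & forall x y : 'I_n, connect e x y].

Section Matrices.
Variable R : realType.

Definition ones (n : nat) : 'cV[R]_n := const_mx 1.

(* Not the canonical norm on matrices of mathcomp-analysis, which is the
   sup norm. *)
Definition enorm (n : nat) (x : 'cV[R]_n) : R :=
  Num.sqrt (\sum_(i < n) x i 0 ^+ 2).

Definition quad (n : nat) (M : 'M[R]_n) (x : 'cV[R]_n) : R :=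
  (x^T *m M *m x) 0 0.

Definition adjacency (n : nat) (e : rel 'I_n) : 'M[R]_n :=
  \matrix_(i, j) (e i j)%:R.

Definition degree_mx (n : nat) (e : rel 'I_n) : 'M[R]_n :=
  diag_mx (\row_i #|[set j | e i j]%SET|%:R).

Definition laplacian (n : nat) (e : rel 'I_n) : 'M[R]_n :=
  degree_mx e - adjacency e.

Definition is_laplacian_pinv (n : nat) (L P : 'M[R]_n) : Prop :=
  let Pi := 1%:M - n%:R^-1 *: (ones n *m (ones n)^T) in
  [/\ P^T = P, L *m P = Pi, P *m L = Pi & P *m ones n = 0].

(* L^dagger. For the Laplacian of a connected graph exactly one matrix
   satisfies is_laplacian_pinv; uniqueness is is_laplacian_pinv_uniq, and the
   default 0 is only reached when there is none. *)
Definition laplacian_pinv (n : nat) (e : rel 'I_n) : 'M[R]_n :=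
  xget 0 [set P | is_laplacian_pinv (laplacian e) P].

Lemma is_laplacian_pinv_uniq (n : nat) (L P Q : 'M[R]_n) :
  is_laplacian_pinv L P -> is_laplacian_pinv L Q -> P = Q.
Proof.
move=> [sP _ PL P1] [sQ LQ _ Q1].
have J0 (X : 'M[R]_n) : X^T = X -> X *m ones n = 0 -> (ones n)^T *m X = 0.
  by move=> sX X1; rewrite -[X]sX -trmx_mul X1 trmx0.
have : P *m L *m Q = P *m (L *m Q) by rewrite mulmxA.
rewrite PL LQ mulmxBl mulmxBr mul1mx mulmx1 -scalemxAl -scalemxAr.
by rewrite -mulmxA (J0 _ sQ Q1) mulmx0 mulmxA P1 mul0mx scaler0 !subr0.
Qed.

Definition Delta (n : nat) (e : rel 'I_n) : 'M[R]_n :=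
  let P := laplacian_pinv e in
  diag_mx (\row_i P i i) - (\tr P / n%:R)%:M.

Definition delta (n : nat) (e : rel 'I_n) (v : 'I_n) : R := Delta e v v.

(* Indices start at 0: lam i and u i are lambda_(i+1) and u_(i+1). *)
Definition laplacian_eigenbasis (n : nat) (e : rel 'I_n.+1)
    (lam : 'I_n.+1 -> R) (u : 'I_n.+1 -> 'cV[R]_n.+1) : Prop :=
  [/\ lam ord0 = 0 /\ (forall i : 'I_n.+1, i != ord0 -> 0 < lam i),
      forall i j : 'I_n.+1, (i <= j)%N -> lam i <= lam j,
      forall i, laplacian e *m u i = lam i *: u i,
      forall i j, ((u i)^T *m u j) 0 0 = (i == j)%:R
    & u ord0 = (Num.sqrt n.+1%:R)^-1 *: ones n.+1].

Definition U_mx (n : nat) (u : 'I_n.+1 -> 'cV[R]_n.+1) : 'M[R]_(n.+1, n) :=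
  \matrix_(v, j) u (lift ord0 j) v 0.

Definition D_L (n : nat) (lam : 'I_n.+1 -> R) : 'M[R]_n :=
  diag_mx (\row_j (lam (lift ord0 j))^-1).

Definition M_L (n : nat) (e : rel 'I_n.+1) (u : 'I_n.+1 -> 'cV[R]_n.+1) :
    'M[R]_n :=
  (U_mx u)^T *m Delta e *m U_mx u.

Definition unit_sphere (n : nat) : set 'cV[R]_n := [set a | enorm a = 1].

Definition unit_sphere_perp1 (n : nat) : set 'cV[R]_n :=
  [set w | (ones n)^T *m w = 0 /\ enorm w = 1].

Definition is_max (T : Type) (A : set T) (f : T -> R) (m : R) : Prop :=
  (f @` A) m /\ ubound (f @` A) m.

Definition objective_a (n : nat) (e : rel 'I_n.+1)
    (lam : 'I_n.+1 -> R) (u : 'I_n.+1 -> 'cV[R]_n.+1) (a : 'cV[R]_n) : R :=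
  2 * quad (D_L lam) a + n.+1%:R * quad (M_L e u) a.

Definition objective_w (n : nat) (e : rel 'I_n) (w : 'cV[R]_n) : R :=
  2 * quad (laplacian_pinv e) w + n%:R * \sum_(v < n) delta e v * w v 0 ^+ 2.

End Matrices.

(* Main.v *)
Require Import Defs.
From mathcomp Require Import all_boot all_order all_algebra.
From mathcomp Require Import all_classical all_reals.
From mathcomp Require Import topology normedtype derive.

Set Implicit Arguments.
Unset Strict Implicit.
Unset Printing Implicit Defensive.

Import Order.TTheory GRing.Theory Num.Theory.
Import numFieldNormedType.Exports.
Local Open Scope classical_set_scope.
Local Open Scope ring_scope.

(** The columns of U are an orthonormal basis of the hyperplane orthogonal to
    the all-ones vector: completing U by u_1 gives a square matrix with
    orthonormal columns, hence with orthonormal rows, and this reads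
    U^T U = I and U U^T = I - 11^T/n.  So a |-> U a is an isometry onto that
    hyperplane, with inverse w |-> U^T w, and it carries one unit sphere
    bijectively onto the other.

    The objectives agree along this bijection, term by term.  Since Delta is
    diagonal, a^T M_L a = (U a)^T Delta (U a) is the weighted sum of squares of
    the entries of U a.  Since L U = U D_L^-1, the matrix U D_L U^T satisfies
    the equations that characterize the Moore-Penrose inverse, so it is
    L^dagger, and w^T L^dagger w = a^T D_L a for w = U a.

    Finally the common maximum exists because the objective in a is a
    quadratic form, hence continuous, on the compact unit sphere, which is
    nonempty as n >= 2; the bijection transports it to the objective in w. *)

(** * Quadratic forms and the Euclidean norm *)

Section QuadraticForms.
Variable R : realType.

Lemma quadE n (M : 'M[R]_n) (x : 'cV[R]_n) :
  quad M x = \sum_(i < n) \sum_(j < n) x i 0 * M i j * x j 0.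
Proof.
rewrite /quad mxE exchange_big; apply: eq_bigr => j _ /=.
by rewrite mxE mulr_suml; apply: eq_bigr => i _; rewrite mxE.
Qed.

Lemma quad_diag n (M : 'M[R]_n) (x : 'cV[R]_n) :
  is_diag_mx M -> quad M x = \sum_(i < n) M i i * x i 0 ^+ 2.
Proof.
move=> /is_diag_mxP dM; rewrite quadE; apply: eq_bigr => i _.
rewrite (bigD1 i) //= big1 ?addr0 => [|j ji]; first by rewrite mulrAC mulrC expr2.
by rewrite dM ?mulr0 ?mul0r // eq_sym.
Qed.

Lemma enormE n (x : 'cV[R]_n) : enorm x = Num.sqrt (quad 1%:M x).
Proof.
rewrite /enorm quad_diag ?scalar_mx_is_diag //; congr Num.sqrt.
by apply: eq_bigr => i _; rewrite mxE eqxx mul1r.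
Qed.

Lemma quad1_ge0 n (x : 'cV[R]_n) : 0 <= quad 1%:M x.
Proof.
rewrite quad_diag ?scalar_mx_is_diag //; apply: sumr_ge0 => i _.
by rewrite mxE eqxx mul1r sqr_ge0.
Qed.

Lemma enorm_eq1 n (x : 'cV[R]_n) : enorm x = 1 <-> quad 1%:M x = 1.
Proof.
rewrite enormE; split=> [x1|->]; last exact: sqrtr1.
by rewrite -[LHS]sqr_sqrtr ?quad1_ge0 // x1 expr1n.
Qed.

Lemma quad_congr m n (U : 'M[R]_(m, n)) (M : 'M[R]_m) (a : 'cV[R]_n) :
  quad (U^T *m M *m U) a = quad M (U *m a).
Proof. by rewrite /quad trmx_mul !mulmxA. Qed.

Lemma quad_lin n (s t : R) (A B : 'M[R]_n) (x : 'cV[R]_n) :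
  s * quad A x + t * quad B x = quad (s *: A + t *: B) x.
Proof. by rewrite /quad mulmxDr mulmxDl -!scalemxAr -!scalemxAl !mxE. Qed.

Lemma continuous_quad n (M : 'M[R]_n) :
  continuous (fun r : 'rV[R]_n => quad M r^T).
Proof.
rewrite (_ : (fun _ => _) =
  fun r : 'rV[R]_n => \sum_(i < n) \sum_(j < n) r 0 i * M i j * r 0 j); last first.
  apply/funext => r; rewrite quadE.
  by apply: eq_bigr => i _; apply: eq_bigr => j _; rewrite !mxE.
apply: (@continuous_big R _ +%R) => [|i _]; first exact: add_continuous.
apply: (@continuous_big R _ +%R) => [|j _ r]; first exact: add_continuous.
have coord (i' : 'I_n) : {for r, continuous (fun r : 'rV[R]_n => r 0 i' : R)}.
  exact: coord_continuous.
exact: (continuousM (continuousM (coord i) (@cst_continuous _ _ (M i j) r))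
                    (coord j)).
Qed.

(** The sphere is closed, being a level set of the quadratic form of the
    identity, and lies in the cube with entries in [-1, 1], which is compact
    by Tychonoff (rV_compact); that lemma speaks of row vectors, hence the
    transpositions here and in continuous_quad. *)
Lemma compact_sphere n : compact [set r : 'rV[R]_n | unit_sphere r^T].
Proof.
pose cube : set 'rV[R]_n := [set v | forall i, `[-1, 1]%classic (v ord0 i)].
apply: (@subclosed_compact _ _ cube).
- rewrite (_ : [set r | _] =
    (fun r : 'rV[R]_n => quad 1%:M r^T) @^-1` [set x | x = 1]).
    apply: preimage_closed; last exact: closed_eq.
    by move=> r _; apply: continuous_quad.
  by apply/seteqP; split=> r /enorm_eq1.
- have := @rV_compact R n (fun=> `[-1, 1]%classic).
  by apply => _; apply: segment_compact.
move=> r /enorm_eq1 r1 i /=; rewrite in_itv /= -ler_norml.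
rewrite -(@ler_pXn2r _ 2) ?nnegrE // expr1n real_normK ?num_real // -r1.
rewrite quad_diag ?scalar_mx_is_diag // (bigD1 i) //= !mxE eqxx mul1r lerDl.
by apply: sumr_ge0 => j _; rewrite mxE eqxx mul1r sqr_ge0.
Qed.

Lemma quad_max n (M : 'M[R]_n.+1) :
  exists m, is_max (@unit_sphere R n.+1) (quad M) m.
Proof.
have [|c /set_mem cS cmax] :=
    compact_EVT_max _ (@compact_sphere n.+1)
      (@continuous_subspaceT _ _ _ _ (@continuous_quad _ M)).
  (* the first unit vector: the sphere is nonempty in positive dimension *)
  exists (delta_mx 0 0 : 'cV_n.+1)^T; apply/enorm_eq1.
  rewrite trmxK quad_diag ?scalar_mx_is_diag //.
  rewrite (bigD1 0) //= big1 ?addr0 => [|i i0].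
    by rewrite !mxE !eqxx expr1n mulr1.
  by rewrite !mxE (negbTE i0) expr0n mulr0.
exists (quad M c^T); split; first by exists c^T.
move=> _ [a a1 <-]; rewrite -[a]trmxK; apply: cmax.
by rewrite inE /= trmxK.
Qed.

End QuadraticForms.

Lemma is_max_image (R : realType) (S T : Type) (A : set S) (B : set T)
    (h : S -> T) (f : S -> R) (g : T -> R) (m : R) :
  h @` A = B -> (forall a, A a -> f a = g (h a)) ->
  is_max A f m -> is_max B g m.
Proof.
move=> <- fg; rewrite /is_max image_comp.
by rewrite (_ : f @` A = (g \o h) @` A) //; apply: eq_imagel => a /fg.
Qed.

(** * The Laplacian eigenbasis *)

Lemma tr_laplacian (R : realType) n (e : rel 'I_n) :
  symmetric e -> (laplacian R e)^T = laplacian R e.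
Proof.
move=> esym; rewrite /laplacian linearB /= tr_diag_mx; congr (_ - _).
by apply/matrixP => i j; rewrite !mxE esym.
Qed.

Lemma Delta_is_diag (R : realType) n (e : rel 'I_n) :
  is_diag_mx (Delta R e).
Proof.
by apply/is_diag_mxP => i j ij; rewrite !mxE -val_eqE (negbTE ij) subr0.
Qed.

Section Eigenbasis.
Variables (R : realType) (n : nat) (e : rel 'I_n.+1).
Variables (lam : 'I_n.+1 -> R) (u : 'I_n.+1 -> 'cV[R]_n.+1).
Hypothesis hu : laplacian_eigenbasis e lam u.

Local Notation U := (U_mx u).
Local Notation J := (ones R n.+1).
Local Notation L := (laplacian R e).

Lemma mul_U_mx (a : 'cV[R]_n) : U *m a = \sum_j a j 0 *: u (lift ord0 j).
Proof.
apply/colP => v; rewrite mxE summxE; apply: eq_bigr => j _.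
by rewrite !mxE mulrC.
Qed.

Lemma U_mx_tr_mul : U^T *m U = 1%:M.
Proof.
have [_ _ _ orth _] := hu; apply/matrixP => i j.
rewrite [RHS]mxE -(inj_eq (@lift_inj _ ord0)) -orth !mxE.
by apply: eq_bigr => v _; rewrite !mxE.
Qed.

(** A square matrix with orthonormal columns has orthonormal rows; the term
    11^T/n is the contribution of the first eigenvector. *)
Lemma U_mx_mul_tr : U *m U^T = 1%:M - n.+1%:R^-1 *: (J *m J^T).
Proof.
have [_ _ _ orth u0] := hu.
pose Q : 'M[R]_n.+1 := \matrix_(v, i) u i v 0.
have /mulmx1C QQ : Q^T *m Q = 1%:M.
  apply/matrixP => i j; rewrite [RHS]mxE -orth !mxE.
  by apply: eq_bigr => v _; rewrite !mxE.
apply/matrixP => v w; apply/eqP; rewrite -QQ !mxE eq_sym subr_eq eq_sym.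
rewrite [X in _ == X]big_ord_recl (big_ord1 +%R) !mxE u0 !mxE.
rewrite !mulr1 -expr2 exprVn sqr_sqrtr ?ler0n // addrC.
by apply/eqP; congr (_ + _); apply: eq_bigr => j _; rewrite !mxE.
Qed.

Lemma ones_mul_U_mx : J^T *m U = 0.
Proof.
have [_ _ _ orth u0] := hu.
have -> : J = Num.sqrt n.+1%:R *: u ord0.
  by rewrite u0 scalerA mulfV ?scale1r // sqrtr_eq0 -ltNge ltr0n.
rewrite linearZ -scalemxAl; apply/matrixP => i j; rewrite ord1 !mxE.
rewrite (_ : \sum_k _ = ((u ord0)^T *m u (lift ord0 j)) 0 0).
  by rewrite orth /= mulr0.
by rewrite mxE; apply: eq_bigr => v _; rewrite !mxE.
Qed.

Lemma U_mx_tr_mul_ones : U^T *m J = 0.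
Proof. by apply: trmx_inj; rewrite trmx_mul trmxK ones_mul_U_mx trmx0. Qed.

Lemma laplacian_mul_U_mx :
  L *m U = U *m diag_mx (\row_j lam (lift ord0 j)).
Proof.
have [_ _ eig _ _] := hu; apply/matrixP => v j.
have /colP/(_ v) := eig (lift ord0 j); rewrite [RHS]mxE mulrC => h.
rewrite mul_mx_diag !mxE -h mxE.
by apply: eq_bigr => w _; rewrite [U _ _]mxE.
Qed.

Lemma eigenvalues_mul_D_L :
  diag_mx (\row_j lam (lift ord0 j)) *m D_L lam = 1%:M.
Proof.
have [[_ lam_gt0] _ _ _ _] := hu.
rewrite mulmx_diag -diag_const_mx; congr diag_mx; apply/rowP => j.
by rewrite !mxE mulfV // gt_eqF // lam_gt0.
Qed.

Hypothesis esym : symmetric e.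

(** The matrix on the right inverts L on the range of U and kills the all-ones
    vector; uniqueness of the pseudo-inverse does the rest. *)
Lemma laplacian_pinvE : laplacian_pinv R e = U *m D_L lam *m U^T.
Proof.
set P := _ *m U^T.
have sP : P^T = P by rewrite !trmx_mul trmxK tr_diag_mx mulmxA.
have LP : L *m P = 1%:M - n.+1%:R^-1 *: (J *m J^T).
  rewrite /P !mulmxA laplacian_mul_U_mx -(mulmxA U) eigenvalues_mul_D_L.
  by rewrite mulmx1 U_mx_mul_tr.
have pinvP : is_laplacian_pinv L P.
  split=> //; last by rewrite -mulmxA U_mx_tr_mul_ones mulmx0.
  (* P L is the transpose of L P, and I - 11^T/n is symmetric *)
  apply: trmx_inj; rewrite trmx_mul sP tr_laplacian // LP.
  by rewrite raddfB /= [(_ *: _)^T]linearZ /= trmx1 trmx_mul trmxK.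
exact: (xget_unique 0 pinvP (fun Q hQ => is_laplacian_pinv_uniq hQ pinvP)).
Qed.

Lemma quad_laplacian_pinv (a : 'cV[R]_n) :
  quad (laplacian_pinv R e) (U *m a) = quad (D_L lam) a.
Proof.
rewrite -quad_congr laplacian_pinvE !mulmxA U_mx_tr_mul mul1mx.
by rewrite -mulmxA U_mx_tr_mul mulmx1.
Qed.

Lemma quad_M_L (a : 'cV[R]_n) :
  quad (M_L e u) a = \sum_v delta R e v * (U *m a) v 0 ^+ 2.
Proof. by rewrite quad_congr quad_diag ?Delta_is_diag. Qed.

Lemma objective_aE (a : 'cV[R]_n) :
  objective_a e lam u a = objective_w e (U *m a).
Proof. by rewrite /objective_a quad_M_L -quad_laplacian_pinv. Qed.

Lemma unit_sphere_bij :
  set_bij (unit_sphere (n:=n)) (unit_sphere_perp1 (n:=n.+1))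
    (fun a : 'cV[R]_n => U *m a).
Proof.
have normU (a : 'cV[R]_n) : enorm (U *m a) = enorm a.
  by rewrite !enormE -quad_congr mulmx1 U_mx_tr_mul.
have UK (a : 'cV[R]_n) : U^T *m (U *m a) = a.
  by rewrite mulmxA U_mx_tr_mul mul1mx.
split=> [a a1|a b _ _ /= Uab|w [w1 nw]].
- by split; [rewrite mulmxA ones_mul_U_mx mul0mx|rewrite normU].
- by rewrite -(UK a) Uab UK.
have wE : U *m (U^T *m w) = w.
  by rewrite mulmxA U_mx_mul_tr mulmxBl mul1mx -scalemxAl -mulmxA w1 mulmx0
             scaler0 subr0.
by exists (U^T *m w) => //; rewrite /unit_sphere /= -normU wE.
Qed.

End Eigenbasis.

(* The number of vertices is n = k.+2 >= 2. *)
Theorem theorem2p16 (R : realType) (k : nat) (e : rel 'I_k.+2)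
    (lam : 'I_k.+2 -> R) (u : 'I_k.+2 -> 'cV[R]_k.+2)
    (hG : simple_connected_graph e)
    (hu : laplacian_eigenbasis e lam u) :
  (forall (w : 'cV[R]_k.+2) (a : 'cV[R]_k.+1),
      (ones R k.+2)^T *m w = 0 -> enorm w = 1 ->
      w = \sum_(j < k.+1) a j 0 *: u (lift ord0 j) ->
      quad (M_L e u) a = \sum_(v < k.+2) delta R e v * w v 0 ^+ 2) /\
  [/\ set_bij (unit_sphere (n:=k.+1)) (unit_sphere_perp1 (n:=k.+2))
        (fun a : 'cV[R]_k.+1 => U_mx u *m a),
      forall a : 'cV[R]_k.+1, unit_sphere a ->
        objective_a e lam u a = objective_w e (U_mx u *m a)
    & exists m : R,
        is_max (unit_sphere (n:=k.+1)) (objective_a e lam u) m /\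
        is_max (unit_sphere_perp1 (n:=k.+2)) (objective_w e) m].
Proof.
have [esym _ _] := hG; split; [|split].
- by move=> w a _ _ ->; rewrite quad_M_L mul_U_mx.
- exact: unit_sphere_bij hu.
- by move=> a _; apply: objective_aE.
have [m am] : exists m, is_max (@unit_sphere R k.+1) (objective_a e lam u) m.
  have [m am] := quad_max (2 *: D_L lam + k.+2%:R *: M_L e u).
  exists m; suff -> : objective_a e lam u =
    quad (2 *: D_L lam + k.+2%:R *: M_L e u) by [].
  by apply/funext => a; rewrite -quad_lin.
exists m; split=> //.
apply: (is_max_image (h := fun a => U_mx u *m a) _ _ am) => [|a _].
  have [sub _ sur] := unit_sphere_bij hu.
  by apply/seteqP; split=> // _ [a /sub ? <-].
exact: objective_aE.
Qed.
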